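(* Let $n,d_1,\dots,d_n$ be positive integers, let $A_i,B_i\in\mathbb{C}^{d_i\times d_i}$ be positive semidefinite for $i=1,\dots,n$, and set $A:=\boxplus_{i=1}^nA_i$, $B:=\boxplus_{i=1}^nB_i$, $a:=\boxplus_{i=1}^n\lambda(A_i)$, $b:=\boxplus_{i=1}^n\lambda(B_i)$. Then $$\sigma(AB)\prec_{\log}(a*b)^\downarrow\prec_{\log}a^\downarrow*b^\downarrow=\lambda(A)*\lambda(B).$$
   Context: Kronecker sums: for $A_i\in\mathbb{C}^{d_i\times d_i}$ and $a_i\in\mathbb{R}^{d_i}$, $$\boxplus_{i=1}^nA_i:=\sum_{i=1}^n\mathbb{1}\otimes\cdots\otimes A_i\otimes\cdots\otimes\mathbb{1}\in\bigotimes_{i=1}^n\mathbb{C}^{d_i\times d_i},\qquad \boxplus_{i=1}^na_i:=\sum_{i=1}^n\mathbf{1}\otimes\cdots\otimes a_i\otimes\cdots\otimes\mathbf{1}\in\bigotimes_{i=1}^n\mathbb{R}^{d_i},$$ where in the $i$-th summand $A_i$ (resp. $a_i$) is in the $i$-th tensor factor, $\mathbb{1}$ is the identity matrix and $\mathbf{1}=(1,\dots,1)$. Thus $\boxplus_i a_i$ has entries $\sum_{i=1}^n(a_i)_{x_i}$ indexed by $x\in\{1,\dots,d_1\}\times\cdots\times\{1,\dots,d_n\}$. $\sigma(X)$ is the vector of singular values in decreasing order, and $\lambda(X)$ is the vector of eigenvalues of a Hermitian $X$ in decreasing order (both with multiplicity). $x*y$ denotes componentwise multiplication and $\downarrow$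 decreasing rearrangement. For $x,y\in\mathbb{R}^N$ with nonnegative entries, $x\prec_{\log}y$ means $\prod_{i=1}^kx_i^\downarrow\le\prod_{i=1}^ky_i^\downarrow$ for all $k\in\{1,\dots,N\}$ with equality for $k=N$. *)

(* Defs.v *)
From mathcomp Require Import all_boot all_order all_algebra.
From mathcomp Require Import sesquilinear spectral.
From mathcomp Require Import reals.
From mathcomp Require Import complex.

Set Implicit Arguments.
Unset Strict Implicit.
Unset Printing Implicit Defensive.

Import Order.TTheory GRing.Theory Num.Theory.
Local Open Scope ring_scope.
Local Open Scope sesquilinear_scope.
Local Open Scope complex_scope.

(* 0 <= z on R[i] means that z is real and nonnegative. *)
Definition psdmx (R : realType) (n : nat) (A : 'M[R[i]]_n) : Prop :=
  A \is hermsymmx /\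
  forall u : 'cV[R[i]]_n, 0 <= (u ^t* *m A *m u) ord0 ord0.

(* Nonincreasing order; the default value 0 is only reached when size s < n. *)
Definition decr_row (R : realType) (n : nat) (s : seq R) : 'rV[R]_n :=
  \row_(i < n) nth 0 (sort >=%R s) i.

Definition decr (R : realType) (n : nat) (x : 'rV[R]_n) : 'rV[R]_n :=
  decr_row n [seq x ord0 i | i <- enum 'I_n].

(* The characteristic polynomial is monic and R[i] is algebraically closed, so
   char_poly X = \prod_(z <- eigvals X) ('X - z%:P): these are the n
   eigenvalues of X with (algebraic) multiplicity. *)
Definition eigvals (R : realType) (n : nat) (X : 'M[R[i]]_n) : seq R[i] :=
  sval (closed_field_poly_normal (char_poly X)).

(* Meant for Hermitian X, whose eigenvalues are real. *)
Definition lambda (R : realType) (n : nat) (X : 'M[R[i]]_n) : 'rV[R]_n :=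
  decr_row n [seq complex.Re z | z <- eigvals X].

(* Singular values: square roots of the eigenvalues of X^* X. *)
Definition sigma (R : realType) (n : nat) (X : 'M[R[i]]_n) : 'rV[R]_n :=
  map_mx Num.sqrt (lambda (X ^t* *m X)).

Definition cmul (R : realType) (n : nat) (x y : 'rV[R]_n) : 'rV[R]_n :=
  map2_mx *%R x y.

(* Log-majorization is a relation between vectors with nonnegative entries. *)
Definition log_maj (R : realType) (n : nat) (x y : 'rV[R]_n) : Prop :=
  [/\ forall i, 0 <= x ord0 i,
      forall i, 0 <= y ord0 i,
      forall k : nat, (1 <= k <= n)%N ->
        \prod_(i < n | (i < k)%N) decr x ord0 i
          <= \prod_(i < n | (i < k)%N) decr y ord0 i
    & \prod_(i < n) decr x ord0 i = \prod_(i < n) decr y ord0 i].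

(* The index set {1..d_1} x ... x {1..d_n} of an n-fold tensor product. MathComp
   matrices are indexed by ordinals, so tensors are indexed by 'I_(tdim d)
   through the enumeration of multi_index d; the same enumeration is used for
   vectors and for matrices. *)
Definition multi_index (n : nat) (d : 'I_n -> nat) : finType :=
  {dffun forall i : 'I_n, 'I_(d i)}.

Definition tdim (n : nat) (d : 'I_n -> nat) : nat := #|multi_index d|.

Definition midx (n : nat) (d : 'I_n -> nat) (x : 'I_(tdim d)) :
  multi_index d := enum_val x.

Definition tens_mx (K : comNzRingType) (n : nat) (d : 'I_n -> nat)
    (M : forall i : 'I_n, 'M[K]_(d i)) : 'M[K]_(tdim d) :=
  \matrix_(x, y) \prod_(i < n) M i (midx x i) (midx y i).

Definition tens_row (K : comNzRingType) (n : nat) (d : 'I_n -> nat)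
    (v : forall i : 'I_n, 'rV[K]_(d i)) : 'rV[K]_(tdim d) :=
  \row_x \prod_(i < n) v i ord0 (midx x i).

Definition kron_sum_mx (K : comNzRingType) (n : nat) (d : 'I_n -> nat)
    (A : forall i : 'I_n, 'M[K]_(d i)) : 'M[K]_(tdim d) :=
  \sum_(i < n) tens_mx (fun j => if j == i then A j else 1%:M).

Definition kron_sum_row (K : comNzRingType) (n : nat) (d : 'I_n -> nat)
    (a : forall i : 'I_n, 'rV[K]_(d i)) : 'rV[K]_(tdim d) :=
  \sum_(i < n) tens_row (fun j => if j == i then a j else const_mx 1).

(* Main.v *)
(** Diagonalising the summands gives A = V^* diag(a) V and B = W^* diag(b) W
    with V, W tensor products of unitaries, a and b nonincreasing in each
    coordinate of the multi-index; put U = V W^*.  For the k-th compound norm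
    p(X) = sigma_1(X) ... sigma_k(X) one has p(AB)^2 <= p(A^2 B^2), since
    B A^2 B and A^2 B^2 have the same eigenvalues; hence
    p(AB)^m <= p(A^m B^m) for m = 2^j.  By Cauchy-Binet p(A^m B^m) is at most a
    constant independent of m times the largest (prod_I a prod_J b)^m over the
    nonvanishing k-minors U[I, J].  If U[I, J] is nonzero for a tensor product
    U, then LU factorisation of (a deformation of) the factors yields a k-set
    H lying coordinatewise below both I and J, so that
    prod_I a prod_J b <= prod_H a b.  Letting m tend to infinity removes the
    constant. *)
Require Import Defs.
From mathcomp Require Import all_boot all_order all_algebra.
From mathcomp Require Import perm sesquilinear spectral.
From mathcomp Require Import reals complex.

Set Implicit Arguments.
Unset Strict Implicit.
Unset Printing Implicit Defensive.

Import Order.TTheory GRing.Theory Num.Theory.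
Local Open Scope ring_scope.
Local Open Scope sesquilinear_scope.
Local Open Scope complex_scope.

(** * Minors of tensor products *)

Section CauchyBinet.
Variables (K : comNzRingType) (k n : nat).
Implicit Types (A : 'M[K]_(k, n)) (B : 'M[K]_(n, k)).
Implicit Types f : {ffun 'I_k -> 'I_n}.

(** Multilinearity in the rows: row [i] of the product is a combination of rows of [B]. All maps [f]
    are kept, the non-injective ones contributing zero. *)
Lemma det_mulmx_rowsub A B :
  \det (A *m B) =
  \sum_(f : {ffun 'I_k -> 'I_n}) (\prod_i A i (f i)) * \det (rowsub f B).
Proof.
transitivity (\sum_(f : {ffun 'I_k -> 'I_n}) \sum_(s : 'S_k)
    (-1) ^+ s * \prod_i (A i (f i) * B (f i) (s i))).
  rewrite exchange_big; apply: eq_bigr => /= s _; rewrite -big_distrr /=.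
  congr (_ * _); rewrite -(bigA_distr_bigA (fun i j => A i j * B j (s i))) /=.
  by apply: eq_bigr => i _; rewrite mxE.
apply: eq_bigr => f _; rewrite big_distrr /=; apply: eq_bigr => s _.
rewrite mulrCA big_split /=; do 2!congr (_ * _).
by apply: eq_bigr => i _; rewrite mxE.
Qed.

End CauchyBinet.

Lemma det_mulmx_colsub (K : comNzRingType) k n (A : 'M[K]_(k, n))
    (B : 'M[K]_(n, k)) :
  \det (A *m B) =
  \sum_(f : {ffun 'I_k -> 'I_n}) \det (colsub f A) * \prod_i B (f i) i.
Proof.
rewrite -det_tr trmx_mul det_mulmx_rowsub; apply: eq_bigr => f _.
rewrite mulrC -det_tr trmx_mxsub trmxK; congr (_ * _).
by apply: eq_bigr => i _; rewrite mxE.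
Qed.

Lemma det_rowsub_perm (K : comNzRingType) k n (B : 'M[K]_(n, k)) (s : 'S_k)
    (f g : 'I_k -> 'I_n) : (forall i, g i = f (s i)) ->
  \det (rowsub g B) = (-1) ^+ s * \det (rowsub f B).
Proof.
move=> gE; rewrite -det_perm -det_mulmx -row_permE; congr (\det _).
by apply/matrixP=> i j; rewrite !mxE gE.
Qed.

Lemma det_rowsub_inj (K : comNzRingType) k n (B : 'M[K]_(n, k))
    (f : 'I_k -> 'I_n) : \det (rowsub f B) != 0 -> injective f.
Proof.
move=> nz i j fij; apply/eqP/negPn/negP => ij; case/negP: nz; apply/eqP.
by apply: (determinant_alternate ij) => l; rewrite !mxE fij.
Qed.

(** Summing over maps instead of [k]-subsets counts each subset [k]! times. The Leibniz expansion of
    the minor of [A], reindexed by [f] composed with the inverse of [s], has its sign cancelled by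
    the row permutation in the minor of [B], so every [s] contributes one copy of the
    determinant. *)
Lemma cauchy_binet (K : comNzRingType) k n (A : 'M[K]_(k, n))
    (B : 'M[K]_(n, k)) :
  \det (A *m B) *+ k`! =
  \sum_(f : {ffun 'I_k -> 'I_n}) \det (colsub f A) * \det (rowsub f B).
Proof.
symmetry; transitivity (\sum_(s : 'S_k) \det (A *m B)); last first.
  by rewrite sumr_const card_Sn.
pose c (s : 'S_k) (f : {ffun 'I_k -> 'I_n}) := [ffun i => f (s i)].
transitivity (\sum_(s : 'S_k) \sum_(f : {ffun 'I_k -> 'I_n})
   ((-1) ^+ s * \prod_i A i (f (s i))) * \det (rowsub f B)).
  rewrite exchange_big; apply: eq_bigr => f _; rewrite -big_distrl /=.
  congr (_ * _); apply: eq_bigr => s _; congr (_ * _).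
  by apply: eq_bigr => i _; rewrite mxE.
apply: eq_bigr => s _; rewrite det_mulmx_rowsub (reindex (c s^-1)%g) /=.
  apply: eq_bigr => f _; rewrite mulrAC mulrC; congr (_ * _).
    by apply: eq_bigr => i _; rewrite ffunE permK.
  rewrite (@det_rowsub_perm _ _ _ B (s^-1)%g f) => [|i]; last by rewrite ffunE.
  by rewrite odd_permV signrMK.
exists (c s) => f _; apply/ffunP=> i; rewrite !ffunE ?permK ?permKV //.
Qed.

(** * Division-free LU factorisation over polynomials *)

Section PolyLU.
Variable F : idomainType.

(* A Gaussian elimination without divisions: clearing the pivots into the
   scalar q keeps everything polynomial, and q is nonzero at 0 because all
   pivots are 1 there. *)
Lemma poly_LU n (M : 'M[{poly F}]_n) :
    (forall i j, (M i j).[0] = (i == j)%:R) ->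
  exists (q : {poly F}) (L T : 'M[{poly F}]_n),
  [/\ q.[0] != 0, is_trig_mx L, is_trig_mx T^T & q *: M = L *m T].
Proof.
elim: n M => [|n IHn] M M0.
  exists 1, 1%:M, 1%:M; split.
  - by rewrite hornerE oner_eq0.
  - by rewrite scalar_mx_is_trig.
  - by rewrite trmx1 scalar_mx_is_trig.
  - by apply/matrixP; case.
pose M' : 'M_(1 + n) := M.
pose a := M' 0 0; pose r := ursubmx M'; pose c := dlsubmx M'.
have ME : M' = block_mx a%:M r c (drsubmx M').
  rewrite -[LHS]submxK; congr (block_mx _ _ _ _).
  by rewrite [LHS]mx11_scalar !mxE !lshift0.
have a0 : a.[0] = 1 by rewrite /a M0 eqxx.
(* Schur complement of the pivot, multiplied by [a]. It is again the identity at 0, since [a] is 1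
   and the off-diagonal block [c] vanishes there. *)
pose S := a *: drsubmx M' - c *m r.
have S0 i j : (S i j).[0] = (i == j)%:R.
  rewrite !mxE big_ord1 !mxE hornerD hornerN !hornerM a0 mul1r !M0.
  by rewrite -!val_eqE /= !add1n eqSS mul0r subr0.
have [q [L [T [q0 Ltrig Ttrig qE]]]] := IHn S S0.
have trT : is_trig_mx (block_mx a%:M r 0 T : 'M_(1 + n))^T.
  by rewrite tr_block_mx is_trig_block_mx // Ttrig trmx0 eqxx tr_scalar_mx scalar_mx_is_trig.
have qaE : (q * a) *: M' = (block_mx (q * a)%:M 0 (q *: c) L : 'M_(1 + n))
    *m (block_mx a%:M r 0 T : 'M_(1 + n)).
  rewrite {1}ME mulmx_block scale_block_mx !mul0mx !mulmx0 !addr0.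
  congr (block_mx _ _ _ _).
  - by rewrite scale_scalar_mx -scalar_mxM.
  - by rewrite mul_scalar_mx.
  - by rewrite mul_mx_scalar scalerA mulrC.
  - by rewrite -qE /S scalerBr scalerA -scalemxAl addrC subrK.
exists (q * a), (block_mx (q * a)%:M 0 (q *: c) L : 'M_(1 + n)),
  (block_mx a%:M r 0 T : 'M_(1 + n)); split.
- by rewrite hornerM a0 mulr1.
- by rewrite (@is_trig_block_mx _ 1 n 1 n) // scalar_mx_is_trig eqxx Ltrig.
- exact: trT.
exact: qaE.
Qed.

End PolyLU.

(** * Tensor products indexed by multi-indices *)

Section Tensor.
Variables (n : nat) (d : 'I_n -> nat).

(** Distributivity for a dependent product: tagging places the different ordinals in one type, where
    each coordinate [i] ranges over the values tagged with [i]. *)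
Lemma sum_prod_multi_index (K : comNzRingType)
    (F : forall i : 'I_n, 'I_(d i) -> K) :
  \sum_(x : multi_index d) \prod_i F i (x i) = \prod_i \sum_j F i j.
Proof.
pose T_ (i : 'I_n) : finType := 'I_(d i).
pose P_ i : {ffun T_ i -> K} := [ffun j => F i j].
rewrite (reindex (@dffun_of_fprod _ T_)) /=; last first.
  exact/onW_bij/dffun_of_fprod_bij.
transitivity (\sum_(t : fprod T_) \prod_(i in 'I_n) P_ i (t i)).
  by apply: eq_bigr => t _; apply: eq_bigr => i _; rewrite !ffunE.
rewrite big_fprod -(bigA_distr_big_dep (fun i => tagged_with T_ i)
   (fun i j => untag 0 (P_ i) j)).
apply: eq_bigr => i _; rewrite -(big_tag (fun i j => P_ i j)).
by apply: eq_bigr => j _; rewrite ffunE.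
Qed.

Lemma sum_prod_midx (K : comNzRingType) (F : forall i : 'I_n, 'I_(d i) -> K) :
  \sum_x \prod_i F i (midx x i) = \prod_i \sum_j F i j.
Proof.
rewrite -sum_prod_multi_index (reindex (@midx _ d)) //=.
by apply: onW_bij; apply: enum_val_bij.
Qed.

Lemma tens_mulmx (K : comNzRingType) (M N : forall i : 'I_n, 'M[K]_(d i)) :
  tens_mx M *m tens_mx N = tens_mx (fun i => M i *m N i).
Proof.
apply/matrixP=> x y; rewrite !mxE.
transitivity (\prod_i \sum_j M i (midx x i) j * N i j (midx y i)).
  rewrite -(sum_prod_midx (fun i j => M i (midx x i) j * N i j (midx y i))).
  by apply: eq_bigr => z _; rewrite !mxE big_split.
by apply: eq_bigr => i _; rewrite mxE.
Qed.

Lemma eq_tens_mx (K : comNzRingType) (M N : forall i : 'I_n, 'M[K]_(d i)) :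
  (forall i, M i = N i) -> tens_mx M = tens_mx N.
Proof.
by move=> MN; apply/matrixP=> x y; rewrite !mxE; apply: eq_bigr => i _; rewrite MN.
Qed.

Lemma midx_inj : injective (@midx _ d).
Proof. exact: enum_val_inj. Qed.

Lemma prod_midx_eq (K : comNzRingType) (x y : 'I_(tdim d)) :
  \prod_i (midx x i == midx y i)%:R = (x == y)%:R :> K.
Proof.
have [->|xy] := eqVneq x y; first by rewrite big1 // => i _; rewrite eqxx.
have /existsP[i ne_i] : [exists i, midx x i != midx y i].
  rewrite -negb_forall; apply: contra xy => /forallP xyE.
  by apply/eqP/midx_inj/ffunP=> i; apply/eqP.
by rewrite (bigD1 i) //= (negPf ne_i) mul0r.
Qed.

Lemma tens_mx_diag (K : comNzRingType) (D : forall i : 'I_n, 'rV[K]_(d i)) :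
  tens_mx (fun i => diag_mx (D i)) = diag_mx (tens_row D).
Proof.
apply/matrixP=> x y; rewrite !mxE -mulr_natr -prod_midx_eq -big_split /=.
by apply: eq_bigr => i _; rewrite mxE mulr_natr.
Qed.

Lemma tens_mx1 (K : comNzRingType) :
  tens_mx (fun i => 1%:M : 'M[K]_(d i)) = 1%:M.
Proof.
apply/matrixP=> x y; rewrite !mxE -(prod_midx_eq K).
by apply: eq_bigr => i _; rewrite mxE.
Qed.

Lemma tens_mxZ (K : comNzRingType) (q : 'I_n -> K)
    (M : forall i : 'I_n, 'M[K]_(d i)) :
  tens_mx (fun i => q i *: M i) = (\prod_i q i) *: tens_mx M.
Proof.
apply/matrixP=> x y; rewrite !mxE -big_split /=.
by apply: eq_bigr => i _; rewrite mxE.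
Qed.

Lemma map_tens_mx (K K' : comNzRingType) (phi : {rmorphism K -> K'})
    (M : forall i : 'I_n, 'M[K]_(d i)) :
  map_mx phi (tens_mx M) = tens_mx (fun i => map_mx phi (M i)).
Proof.
apply/matrixP=> x y; rewrite !mxE rmorph_prod.
by apply: eq_bigr => i _; rewrite mxE.
Qed.

Lemma tr_tens_mx (K : comNzRingType) (M : forall i : 'I_n, 'M[K]_(d i)) :
  (tens_mx M)^T = tens_mx (fun i => (M i)^T).
Proof.
by apply/matrixP=> x y; rewrite !mxE; apply: eq_bigr => i _; rewrite mxE.
Qed.

Lemma kron_sum_rowE (K : comNzRingType) (a : forall i : 'I_n, 'rV[K]_(d i)) x :
  kron_sum_row a ord0 x = \sum_i a i ord0 (midx x i).
Proof.
rewrite summxE; apply: eq_bigr => i _; rewrite mxE (bigD1 i) //= eqxx.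
by rewrite big1 ?mulr1 // => j /negPf->; rewrite mxE.
Qed.

(** A nonzero entry forces every factor to be nonzero, so triangularity can be read off in each
    coordinate separately. This is the source of the coordinatewise order on multi-indices. *)
Lemma tens_mx_trig_neq0 (K : idomainType) (L : forall i : 'I_n, 'M[K]_(d i))
    x y :
  (forall i, is_trig_mx (L i)) -> tens_mx L x y != 0 ->
  forall i, (midx y i <= midx x i)%N.
Proof.
move=> Ltrig; rewrite mxE => /prodf_neq0 nz i; rewrite leqNgt; apply/negP=> lt.
by have := nz i isT; rewrite (is_trig_mxP _ _) ?eqxx //.
Qed.

(* Each U i is deformed to (1 - t) + t (U i), whose LU decomposition exists
   over the polynomials in t; a minor that survives at t = 1 is a nonzero
   polynomial, hence so is some term of its Cauchy-Binet expansion. *)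
Lemma tens_minor_neq0 (K : idomainType) (U : forall i : 'I_n, 'M[K]_(d i))
    k (f g : 'I_k -> 'I_(tdim d)) :
    \det (mxsub f g (tens_mx U)) != 0 ->
  exists (h : 'I_k -> 'I_(tdim d)) (s : 'S_k),
  [/\ injective h, forall l i, (midx (h l) i <= midx (f l) i)%N
    & forall l i, (midx (h l) i <= midx (g (s l)) i)%N].
Proof.
move=> nzU.
pose M i : 'M[{poly K}]_(d i) :=
  \matrix_(x, y) ((x == y)%:R%:P + 'X * (U i x y - (x == y)%:R)%:P).
have M0 i x y : (M i x y).[0] = (x == y)%:R.
  by rewrite mxE hornerD hornerM hornerX !hornerC mul0r addr0.
have M1 i : map_mx (horner_eval 1) (M i) = U i.
  apply/matrixP=> x y; rewrite !mxE /horner_eval hornerD hornerM hornerX.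
  by rewrite !hornerC mul1r addrC subrK.
have /fin_all_exists[q /fin_all_exists[L /fin_all_exists[T LTP]]] i :=
  poly_LU (M0 i).
have nzM : \det (mxsub f g (tens_mx M)) != 0.
  apply: contra nzU => /eqP/(congr1 (horner_eval 1)).
  rewrite -det_map_mx map_mxsub map_tens_mx (eq_tens_mx M1) => ->.
  by rewrite /horner_eval horner0.
(* Clearing the pivots only scales the minor by the [k]-th power of the product of the [q i], which
   are nonzero because their values at 0 are. *)
have : \det (mxsub f g (tens_mx L *m tens_mx T)) != 0.
  have LTE i : L i *m T i = q i *: M i by case: (LTP i).
  rewrite tens_mulmx (eq_tens_mx LTE) tens_mxZ linearZ /= detZ mulf_neq0 //.
  rewrite expf_neq0 //; apply/prodf_neq0 => i _; have [q0 _ _ _] := LTP i.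
  by apply: contraNneq q0 => ->; rewrite horner0.
rewrite mxsub_mul det_mulmx_rowsub => nz.
have /existsP[h] : [exists h : {ffun 'I_k -> 'I_(tdim d)},
    (\prod_i rowsub f (tens_mx L) i (h i)) *
      \det (rowsub h (colsub g (tens_mx T))) != 0].
  apply: contraNT nz; rewrite negb_exists => /forallP all0.
  by rewrite big1 // => h _; apply/eqP; rewrite -[_ == _]negbK.
rewrite mulf_eq0 negb_or => /andP[/prodf_neq0 nzL nzT].
(* A nonzero Leibniz term of the second minor matches the positions of [h] with those of [g]. *)
have /existsP[s /prodf_neq0 nzs] : [exists s : 'S_k,
    \prod_i rowsub h (colsub g (tens_mx T)) i (s i) != 0].
  apply: contraNT nzT; rewrite negb_exists => /forallP all0.
  rewrite /determinant big1 // => s _; apply/eqP.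
  by rewrite mulf_eq0 -[X in _ || X]negbK all0 orbT.
exists h, s; split=> [|l i|l i]; first exact: det_rowsub_inj nzT.
  have := nzL l isT; rewrite mxE => /tens_mx_trig_neq0; apply=> {}i.
  by have [_ ? _ _] := LTP i.
have TE x y : tens_mx T x y = tens_mx (fun i => (T i)^T) y x.
  by rewrite -tr_tens_mx [RHS]mxE.
have := nzs l isT; rewrite [rowsub _ _ _ _]mxE [colsub _ _ _ _]mxE TE.
move=> /tens_mx_trig_neq0; apply=> {}i.
by have [_ _ ? _] := LTP i.
Qed.
End Tensor.

(** * Products of the k largest entries *)

Definition nonincreasing_row (R : realType) n (x : 'rV[R]_n) :=
  forall i j : 'I_n, (i <= j)%N -> x ord0 j <= x ord0 i.

(** For nonnegative entries and [k <= n], the largest product over [k] distinct positions; at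
    singular values it is the operator norm of the [k]-th compound. *)
Definition topk (R : realType) n (k : nat) (x : 'rV[R]_n) : R :=
  \prod_(i < n | (i < k)%N) decr x ord0 i.

Section Decreasing.
Variables (R : realType) (n : nat).
Implicit Types (x y : 'rV[R]_n) (s : seq R).

Lemma decr_row_nonincreasing s : size s = n -> nonincreasing_row (decr_row n s).
Proof.
move=> sn i j ij; rewrite !mxE.
have ge_trans : transitive (>=%R : rel R) by move=> ? ? ? /[swap]; apply: le_trans.
apply: (sorted_leq_nth ge_trans (@lexx _ R)) => //; rewrite ?inE ?size_sort ?sn //.
by apply: sort_sorted => u v; apply: le_total.
Qed.

Lemma size_row_entries x : size [seq x ord0 i | i <- enum 'I_n] = n.
Proof. by rewrite size_map size_enum_ord. Qed.

Lemma decr_nonincreasing x : nonincreasing_row (decr x).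
Proof. exact/decr_row_nonincreasing/size_row_entries. Qed.

Lemma perm_decr_row s s' : perm_eq s s' -> decr_row n s = decr_row n s'.
Proof.
move=> /(perm_sortP (leT := >=%R)) E; apply/rowP=> i; rewrite !mxE E //.
- by move=> u v; apply: le_total.
- by move=> ? ? ? /[swap]; apply: le_trans.
- by move=> u v /andP[uv vu]; apply: le_anti; apply/andP; split.
Qed.

Lemma nth_row_entries x (i : 'I_n) :
  nth 0 [seq x ord0 i | i <- enum 'I_n] i = x ord0 i.
Proof. by rewrite (nth_map i) ?size_enum_ord // nth_ord_enum. Qed.

Lemma decr_id x : nonincreasing_row x -> decr x = x.
Proof.
move=> xdec; apply/rowP=> i; rewrite mxE sorted_sort ?nth_row_entries //.
  by move=> ? ? ? /[swap]; apply: le_trans.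
apply/(sortedP 0) => j; rewrite size_row_entries => jn.
have := nth_row_entries x (Ordinal jn); have := nth_row_entries x (Ordinal (ltnW jn)).
by move=> /= -> ->; apply: xdec => /=.
Qed.

Lemma decr_perm x : exists s : 'S_n, forall i, decr x ord0 i = x ord0 (s i).
Proof.
(* Positions are sorted instead of values, which yields a permutation even when entries repeat. *)
pose e := sort (relpre (x ord0) >=%R) (enum 'I_n).
have eU : uniq e by rewrite sort_uniq enum_uniq.
have eS : size e = n by rewrite size_sort size_enum_ord.
have finj : injective (fun i : 'I_n => nth i e i).
  move=> i j; rewrite (set_nth_default i j) ?eS // => /eqP.
  by rewrite nth_uniq ?eS // => /eqP/val_inj.
exists (perm finj) => i; rewrite permE mxE sort_map (nth_map i) ?eS //.
Qed.

Lemma decr_ge0 x : (forall i, 0 <= x ord0 i) -> forall i, 0 <= decr x ord0 i.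
Proof. by move=> x0 i; have [s ->] := decr_perm x. Qed.

Lemma prod_decr x : \prod_i decr x ord0 i = \prod_i x ord0 i.
Proof.
have [s sE] := decr_perm x; rewrite [RHS](reindex_inj (@perm_inj _ s)).
by apply: eq_bigr => i _; rewrite sE.
Qed.

Lemma topk_decr k x : topk k (decr x) = topk k x.
Proof. by rewrite /topk (decr_id (@decr_nonincreasing x)). Qed.

Lemma topk_id k x : nonincreasing_row x ->
  topk k x = \prod_(i < n | (i < k)%N) x ord0 i.
Proof. by move=> xdec; rewrite /topk decr_id. Qed.

Lemma topk_ge0 k x : (forall i, 0 <= x ord0 i) -> 0 <= topk k x.
Proof. by move=> x0; apply: prodr_ge0 => i _; apply: decr_ge0. Qed.

(** Induction on the cardinal: the largest position [j] of a set of [k.+1] positions is at least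
    [k], so its entry is at most the one at [k]; then [j] is removed. *)
Lemma prod_set_le_first x (S : {set 'I_n}) :
  (forall i, 0 <= x ord0 i) -> nonincreasing_row x ->
  \prod_(i in S) x ord0 i <= \prod_(i < n | (i < #|S|)%N) x ord0 i.
Proof.
move=> x0 xdec; move: {2}#|S| (erefl #|S|) => k; elim: k S => [|k IHk] S Sk.
  by rewrite Sk (cards0_eq Sk) big_set0 big1.
have [i0 i0S] : exists i, i \in S by apply/set0Pn; rewrite -card_gt0 Sk.
pose j := [arg max_(i > i0 | i \in S) val i]%N.
have [jS jmax] : j \in S /\ forall i, i \in S -> (i <= j)%N.
  by rewrite /j; case: arg_maxnP.
have SjE : #|S :\ j| = k by apply/eqP; rewrite -eqSS -Sk (cardsD1 j S) jS.
have kj : (k <= j)%N.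
  rewrite -ltnS -Sk; have /subset_leq_card : S \subset [set i : 'I_n | (i < j.+1)%N].
    by apply/subsetP=> i iS; rewrite inE ltnS jmax.
  move=> /leq_trans; apply; rewrite -sum1_card.
  rewrite (eq_bigl (fun i : 'I_n => (i < j.+1)%N)) => [|i]; last by rewrite inE.
  by rewrite -(big_ord_widen n (fun=> 1%N)) // sum1_card card_ord.
have kn : (k < n)%N by apply: leq_ltn_trans kj _.
rewrite Sk (bigD1 j jS) /= [X in _ <= X](bigD1 (Ordinal kn)) //=.
apply: ler_pM => //; [by apply: prodr_ge0 | exact: xdec |].
have := IHk _ SjE; rewrite SjE.
rewrite (eq_bigl (fun i => (i \in S) && (i != j))) => [|i]; last first.
  by rewrite !inE andbC.
move=> /le_trans; apply; rewrite le_eqVlt; apply/orP; left; apply/eqP.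
apply: eq_bigl => i; rewrite -val_eqE /= ltnS [in RHS]leq_eqVlt.
by case: ltngtP.
Qed.

Lemma prod_set_le_topk x (S : {set 'I_n}) : (forall i, 0 <= x ord0 i) ->
  \prod_(i in S) x ord0 i <= topk #|S| x.
Proof.
move=> x0; have [s sE] := decr_perm x.
have -> : \prod_(i in S) x ord0 i = \prod_(i in s @^-1: S) decr x ord0 i.
  rewrite (reindex_inj (@perm_inj _ s)) /=.
  by apply: eq_big => i; rewrite ?inE // sE.
rewrite -(card_preimset S (@perm_inj _ s)).
by apply: prod_set_le_first; [apply: decr_ge0 | apply: decr_nonincreasing].
Qed.

Lemma topk_attained k x : (k <= n)%N ->
  exists2 f : 'I_k -> 'I_n, injective f & topk k x = \prod_i x ord0 (f i).
Proof.
move=> kn; have [s sE] := decr_perm x.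
exists (fun i => s (widen_ord kn i)).
  by move=> i j /perm_inj/(congr1 val) /= /val_inj.
rewrite /topk (big_ord_narrow kn).
by apply: eq_bigr => i _; rewrite sE.
Qed.

Lemma prod_inj_le_topk k x (f : 'I_k -> 'I_n) : (forall i, 0 <= x ord0 i) ->
  injective f -> \prod_i x ord0 (f i) <= topk k x.
Proof.
move=> x0 finj; have := prod_set_le_topk (f @: [set: 'I_k]) x0.
rewrite card_imset // cardsT card_ord; apply: le_trans.
rewrite big_imset /=; last by move=> ? ? _ _; apply: finj.
by rewrite le_eqVlt; apply/orP; left; apply/eqP/eq_bigl => i; rewrite inE.
Qed.

Lemma cmul_nonincreasing x y :
  (forall i, 0 <= x ord0 i) -> (forall i, 0 <= y ord0 i) ->
  nonincreasing_row x -> nonincreasing_row y -> nonincreasing_row (cmul x y).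
Proof. by move=> x0 y0 dx dy i j ij; rewrite !mxE ler_pM ?dx ?dy. Qed.

(** Positions optimal for the componentwise product are admissible for [x] and for [y]
    separately. *)
Lemma topk_cmul_le k x y : (k <= n)%N ->
  (forall i, 0 <= x ord0 i) -> (forall i, 0 <= y ord0 i) ->
  topk k (cmul x y) <= topk k x * topk k y.
Proof.
move=> kn x0 y0; have [f finj ->] := topk_attained (cmul x y) kn.
rewrite (eq_bigr (fun i => x ord0 (f i) * y ord0 (f i))) => [|i _]; last by rewrite mxE.
rewrite big_split ler_pM ?prod_inj_le_topk //; apply: prodr_ge0 => i _ //.
Qed.

(** The second relation of the theorem, for arbitrary nonnegative vectors. The right-hand side is
    already sorted, so its leading products factor. *)
Lemma log_maj_cmul_decr x y :
  (forall i, 0 <= x ord0 i) -> (forall i, 0 <= y ord0 i) ->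
  log_maj (decr (cmul x y)) (cmul (decr x) (decr y)).
Proof.
move=> x0 y0; have xy0 i : 0 <= cmul x y ord0 i by rewrite mxE mulr_ge0.
have dx0 := decr_ge0 x0; have dy0 := decr_ge0 y0.
have dxy : nonincreasing_row (cmul (decr x) (decr y)).
  by apply: cmul_nonincreasing => //; apply: decr_nonincreasing.
split=> [|i|k /andP[_ kn]|]; first exact: decr_ge0.
- by rewrite mxE mulr_ge0.
- rewrite -[X in X <= _]/(topk k (decr _)) -[X in _ <= X]/(topk k _) topk_decr.
  rewrite (topk_id k dxy); apply: le_trans (topk_cmul_le kn x0 y0) _.
  by rewrite /topk -big_split /= le_eqVlt; apply/orP; left; apply/eqP/eq_bigr => i _; rewrite [RHS]mxE.
- rewrite !prod_decr.
  under eq_bigr do rewrite mxE; under [RHS]eq_bigr do rewrite mxE.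
  by rewrite !big_split /= !prod_decr.
Qed.

End Decreasing.

(** * Removing a constant factor, and weights on nonvanishing minors *)

Lemma bernoulli_ineq (R : realType) (e : R) m : 0 <= e ->
  1 + e *+ m <= (1 + e) ^+ m.
Proof.
move=> e0; elim: m => [|m IHm]; first by rewrite mulr0n addr0.
rewrite exprS; apply: le_trans (_ : (1 + e) * (1 + e *+ m) <= _).
  rewrite mulrDl mul1r mulrDr mulr1 mulrS -addrA lerD2l addrC lerD2l lerDl.
  by rewrite mulr_ge0 // mulrn_wge0.
by rewrite ler_wpM2l // addr_ge0.
Qed.

(** If [M < t] with [M] positive, put [t / M = 1 + e]. Bernoulli's inequality makes the powers of
    [1 + e] unbounded, whereas the hypothesis bounds them by [C]. *)
Lemma le_of_pow2_le (R : realType) (t M C : R) :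
    0 <= M -> (forall j, t ^+ (2 ^ j) <= C * M ^+ (2 ^ j)) ->
  t <= M.
Proof.
move=> M0 tM; rewrite leNgt; apply/negP=> ltMt.
have t0 : 0 < t by apply: le_lt_trans ltMt.
have [M_eq0|M_neq0] := eqVneq M 0.
  by have := tM 0; rewrite expn0 !expr1 M_eq0 mulr0 leNgt t0.
have Mgt0 : 0 < M by rewrite lt_def M_neq0.
pose e := t / M - 1.
have e0 : 0 < e by rewrite subr_gt0 ltr_pdivlMr // mul1r.
have rC j : (1 + e) ^+ (2 ^ j) <= C.
  by rewrite addrC subrK expr_div_n ler_pdivrMr ?exprn_gt0.
have [j] : exists j : nat, C / e < j%:R.
  have [C0|C0] := ltP (C / e) 0; first by exists 0.
  by exists (Num.trunc (C / e)).+1; rewrite truncnS_gt.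
rewrite ltr_pdivrMr // => Cj.
have := le_trans (bernoulli_ineq (2 ^ j) (ltW e0)) (rC j).
apply/negP; rewrite -ltNge; apply: lt_le_trans Cj _.
rewrite mulrC mulr_natr; apply: ler_wpDl => //.
by rewrite ler_pMn2l // ltnW // ltn_expl.
Qed.

(** The positions [h] lie below [f] and below a reordering of [g], so antitone weights only grow on
    passing to [h]; injectivity of [h] then gives the bound by [topk]. *)
Lemma tens_minor_bound (R : realType) (K : idomainType) n (d : 'I_n -> nat)
    (U : forall i : 'I_n, 'M[K]_(d i)) (a b : 'rV[R]_(tdim d))
    k (f g : 'I_k -> 'I_(tdim d)) :
    (forall x, 0 <= a ord0 x) -> (forall x, 0 <= b ord0 x) ->
    (forall x y, (forall i, midx x i <= midx y i)%N -> a ord0 y <= a ord0 x) ->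
    (forall x y, (forall i, midx x i <= midx y i)%N -> b ord0 y <= b ord0 x) ->
    \det (mxsub f g (tens_mx U)) != 0 ->
  (\prod_l a ord0 (f l)) * (\prod_l b ord0 (g l)) <= topk k (cmul a b).
Proof.
move=> a0 b0 adec bdec /tens_minor_neq0[h [s [hinj hf hg]]].
rewrite [X in _ * X](reindex_inj (@perm_inj _ s)) -big_split /=.
apply: le_trans (prod_inj_le_topk _ hinj); last by move=> i; rewrite mxE mulr_ge0.
apply: ler_prod => l _; rewrite mulr_ge0 //= mxE.
by apply: ler_pM => //; [apply: adec | apply: bdec].
Qed.

(** * Compound norms *)

Lemma trmxC_mul (K : numClosedFieldType) m n p (A : 'M[K]_(m, n))
    (B : 'M[K]_(n, p)) : (A *m B)^t* = B^t* *m A^t*.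
Proof. by rewrite trmx_mul map_mxM. Qed.

Lemma det_trmxC (K : numClosedFieldType) n (A : 'M[K]_n) :
  \det (A^t*) = (\det A)^*%R.
Proof. by rewrite det_map_mx det_tr. Qed.

Lemma hermsymmxP (K : numClosedFieldType) n (A : 'M[K]_n) :
  reflect (A^t* = A) (A \is hermsymmx).
Proof.
by apply: (iffP (is_hermitianmxP _ _ _)); rewrite expr0 scale1r => /esym.
Qed.

Lemma unitarymxC (K : numClosedFieldType) n (V : 'M[K]_n) :
  V \is unitarymx -> V^t* *m V = 1%:M.
Proof. by rewrite -trmxC_unitary => /unitarymxP; rewrite trmxCK. Qed.

Lemma char_poly_conj (K : fieldType) n (P D : 'M[K]_n) :
  P \in unitmx -> char_poly (invmx P *m D *m P) = char_poly D.
Proof.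
move=> Pu; rewrite /char_poly.
have -> : char_poly_mx (invmx P *m D *m P) =
    map_mx polyC (invmx P) *m char_poly_mx D *m map_mx polyC P.
  rewrite /char_poly_mx mulmxBr mulmxBl -!map_mxM; congr (_ - _).
  rewrite scalar_mxC -mulmxA -map_mxM mulVmx // map_mx1 mulmx1 //.
rewrite !det_mulmx mulrAC -det_mulmx -map_mxM mulVmx // map_mx1 det1 mul1r //.
Qed.

Lemma gram_unitary (K : numClosedFieldType) n k (V : 'M[K]_n)
    (W : 'M[K]_(n, k)) :
  V \is unitarymx -> (V *m W)^t* *m (V *m W) = W^t* *m W.
Proof.
by move=> Vu; rewrite trmxC_mul -mulmxA [V^t* *m _]mulmxA unitarymxC // mul1mx.
Qed.

Lemma rowsub_mul_diag (K : comNzRingType) n k p (f : 'I_k -> 'I_n)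
    (l : 'rV[K]_n) (N : 'M[K]_(n, p)) :
  rowsub f (diag_mx l *m N) = diag_mx (colsub f l) *m rowsub f N.
Proof. by apply/matrixP=> i j; rewrite [LHS]mxE !mul_diag_mx !mxE. Qed.

(* For f not injective the corresponding minor vanishes; the factor k! counts
   the orderings of each k-subset. *)
Lemma det_gram_diag (K : numClosedFieldType) n k (W : 'M[K]_(n, k))
    (l : 'rV[K]_n) :
  \det (W^t* *m diag_mx l *m W) *+ k`! =
  \sum_(f : {ffun 'I_k -> 'I_n})
     (\prod_i l ord0 (f i)) * `|\det (rowsub f W)| ^+ 2.
Proof.
rewrite cauchy_binet; apply: eq_bigr => f _.
have -> : colsub f (W^t* *m diag_mx l) =
    (rowsub f W)^t* *m diag_mx (colsub f l).
  by apply/matrixP=> i j; rewrite [LHS]mxE !mul_mx_diag !mxE.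
rewrite det_mulmx det_trmxC det_diag normCK mulrAC mulrC [X in _ * X]mulrC.
by congr (_ * _); apply: eq_bigr => i _; rewrite mxE.
Qed.

Lemma det_gram (K : numClosedFieldType) n k (W : 'M[K]_(n, k)) :
  \det (W^t* *m W) *+ k`! =
  \sum_(f : {ffun 'I_k -> 'I_n}) `|\det (rowsub f W)| ^+ 2.
Proof.
rewrite -[in LHS](mulmx1 (W^t*)) -diag_const_mx det_gram_diag.
by apply: eq_bigr => f _; rewrite big1 ?mul1r // => i _; rewrite mxE.
Qed.

Lemma det_gram_ge0 (K : numClosedFieldType) n k (W : 'M[K]_(n, k)) :
  0 <= \det (W^t* *m W).
Proof.
rewrite -(pmulrn_lge0 _ (fact_gt0 k)) det_gram.
by apply: sumr_ge0 => f _; rewrite exprn_ge0.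
Qed.

Lemma det_gram_sqr (K : numClosedFieldType) n (X : 'M[K]_n) :
  \det (X^t* *m X) = `|\det X| ^+ 2.
Proof. by rewrite det_mulmx det_trmxC mulrC normCK. Qed.

(** * Unitary diagonalisation and top eigenvalues of compounds *)

Section UnitaryDiag.
Variables (K : numClosedFieldType) (n : nat).
Implicit Types (V W : 'M[K]_n) (l m : 'rV[K]_n).

(** For unitary [V], the columns of [V^t*] are eigenvectors with eigenvalues [l]. *)
Definition spec V l : 'M[K]_n := V^t* *m diag_mx l *m V.

Lemma spec_herm V l : (forall i, l ord0 i \is Num.real) ->
  (spec V l)^t* = spec V l.
Proof.
move=> lreal; rewrite !trmxC_mul trmxCK mulmxA tr_diag_mx map_diag_mx.
congr (_ *m diag_mx _ *m _).
by apply/rowP=> i; rewrite !mxE; apply/CrealP.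
Qed.

Lemma specM V l m : V \is unitarymx ->
  spec V l *m spec V m = spec V (map2_mx *%R l m).
Proof.
move=> Vu; rewrite /spec !mulmxA mulmxtVK // -[_ *m diag_mx _ *m diag_mx _]mulmxA.
by rewrite mulmx_diag; congr (_ *m diag_mx _ *m _); apply/rowP=> i; rewrite !mxE.
Qed.

Lemma det_spec V l : V \is unitarymx -> \det (spec V l) = \prod_i l ord0 i.
Proof.
move=> Vu; rewrite !det_mulmx mulrAC -det_mulmx unitarymxC // det1 mul1r.
exact: det_diag.
Qed.

Lemma char_poly_spec V l : V \is unitarymx ->
  char_poly (spec V l) = \prod_i ('X - (l ord0 i)%:P).
Proof.
move=> Vu; rewrite /spec -invmx_unitary // char_poly_conj ?unitarymx_unit //.
rewrite char_poly_trig ?diag_mx_is_trig //.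
by apply: eq_bigr => i _; rewrite !mxE eqxx mulr1n.
Qed.

Lemma perm_mx_unitary (s : 'S_n) : (perm_mx s : 'M[K]_n) \is unitarymx.
Proof.
by apply/unitarymxP; rewrite tr_perm_mx map_perm_mx -perm_mxM mulgV perm_mx1.
Qed.

Lemma spec_perm (s : 'S_n) V l :
  spec (perm_mx s *m V) (\row_i l ord0 (s i)) = spec V l.
Proof.
have sE (i j : 'I_n) : perm_mx s i j = (s i == j)%:R :> K by rewrite !mxE.
rewrite /spec trmxC_mul -!mulmxA; congr (_ *m _).
rewrite ![diag_mx _ *m _]mulmxA.
have -> : diag_mx (\row_i l ord0 (s i)) *m perm_mx s = perm_mx s *m diag_mx l.
  apply/matrixP=> i j; rewrite mul_diag_mx mul_mx_diag [LHS]mxE [RHS]mxE sE mxE.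
  by case: eqP => [->|_]; rewrite ?mulr1 ?mul1r ?mulr0 ?mul0r.
by rewrite !mulmxA unitarymxC ?mul1mx // perm_mx_unitary.
Qed.

Lemma spec_diag_entry V l i (u := V^t* *m delta_mx i ord0 : 'cV[K]_n) :
  V \is unitarymx -> (u^t* *m spec V l *m u) ord0 ord0 = l ord0 i.
Proof.
move=> Vu; rewrite /u /spec trmxC_mul trmxCK !mulmxA mulmxtVK // mulmxtVK //.
rewrite trmx_delta map_delta_mx -rowE -colE !mxE eqxx //.
Qed.

(* The largest eigenvalue of the k-th compound (exterior power) of H, when H
   is positive semidefinite. *)
Definition is_top_det k (H : 'M[K]_n) (t : K) :=
  (forall W : 'M[K]_(n, k), \det (W^t* *m H *m W) <= t * \det (W^t* *m W)) /\
  exists (W : 'M[K]_(n, k)) (D : 'M[K]_k),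
    [/\ W^t* *m W = 1%:M, H *m W = W *m D & \det D = t].

(** After rotation by [V], both determinants become sums over the same squared minors, the left one
    with weights at most the product along [h]; non-injective maps drop out. The eigenvectors
    selected by [h] attain the bound. *)
Lemma spec_top_det k V l (h : 'I_k -> 'I_n) : V \is unitarymx -> injective h ->
    (forall f : 'I_k -> 'I_n, injective f ->
       \prod_i l ord0 (f i) <= \prod_i l ord0 (h i)) ->
  is_top_det k (spec V l) (\prod_i l ord0 (h i)).
Proof.
move=> Vu hinj htop; split.
  move=> W; pose Z := V *m W.
  rewrite -(gram_unitary W Vu) -/Z.
  have -> : W^t* *m spec V l *m W = Z^t* *m diag_mx l *m Z.
    by rewrite /Z /spec trmxC_mul !mulmxA.
  rewrite -(ler_pMn2r (fact_gt0 k)) det_gram_diag -mulrnAr det_gram mulr_sumr.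
  apply: ler_sum => f _; have [->|nz] := eqVneq (\det (rowsub f Z)) 0.
    by rewrite normr0 expr0n !mulr0.
  by rewrite ler_wpM2r ?exprn_ge0 // htop //; apply: det_rowsub_inj nz.
exists (V^t* *m colsub h 1%:M), (diag_mx (colsub h l)); split.
- rewrite trmxC_mul trmxCK mulmxA mulmxtVK //.
  apply/matrixP=> i j; rewrite mulmx_colsub mulmx1 !mxE conjC_nat.
  by rewrite (inj_eq hinj) eq_sym.
- rewrite /spec !mulmxA mulmxtVK // -!mulmxA; congr (_ *m _).
  apply/matrixP=> i j; rewrite mul_diag_mx mul_mx_diag !mxE.
  by case: eqP => [->|_]; rewrite ?mulr1 ?mul1r ?mulr0 ?mul0r.
- by rewrite det_diag; apply: eq_bigr => i _; rewrite mxE.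
Qed.

(* An eigenframe of B A^2 B spans, after applying A^2 B, an invariant subspace
   of A^2 B^2 with the same eigenvalues. *)
Lemma top_det_double k (A B : 'M[K]_n) t t2 tB : A^t* = A -> B^t* = B ->
    0 <= t -> 0 <= t2 ->
    is_top_det k ((A *m B)^t* *m (A *m B)) t ->
    is_top_det k ((A *m A *m (B *m B))^t* *m (A *m A *m (B *m B))) t2 ->
    is_top_det k (B^t* *m B) tB ->
  t ^+ 2 <= t2.
Proof.
move=> AE BE t0 t20 [_ [V [D [VV HV detD]]]] [top2 _] [topB _].
have [->|tn0] := eqVneq t 0; first by rewrite expr0n.
have Du : D \in unitmx by rewrite unitmxE detD unitfE.
(* Normalised by the inverse of [D] so that [B *m W = V]; then [A *m A *m (B *m B)] maps [W] to
   [W *m D]. *)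
pose W := A *m A *m B *m V *m invmx D.
have {}HV : B *m A *m A *m B *m V = V *m D.
  by rewrite -HV trmxC_mul AE BE !mulmxA.
have BW : B *m W = V by rewrite /W !mulmxA HV mulmxK.
have WD : W *m D = A *m A *m B *m V by rewrite /W mulmxKV.
(* The columns of [V] are orthonormal, so a vanishing Gram determinant of [W] would turn the bound
   [topB] into 1 <= 0. *)
have det_gt0 : 0 < \det (W^t* *m W).
  rewrite lt_def det_gram_ge0 andbT.
  have := topB W; rewrite mulmxA -trmxC_mul -mulmxA BW VV det1.
  by apply: contraTneq => ->; rewrite mulr0 ler10.
rewrite -(ler_pM2r det_gt0); apply: le_trans (top2 W).
rewrite mulmxA -trmxC_mul -mulmxA.
have -> : A *m A *m (B *m B) *m W = W *m D by rewrite WD -BW !mulmxA.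
rewrite trmxC_mul -mulmxA [W^t* *m (W *m D)]mulmxA !det_mulmx det_trmxC detD.
by rewrite (CrealP (ger0_real t0)) [leRHS]mulrCA [leRHS]mulrC expr2.
Qed.

Lemma frame_entry_le1 k (Z : 'M[K]_(n, k)) x i : Z^t* *m Z = 1%:M ->
  `|Z x i| <= 1.
Proof.
move=> /matrixP/(_ i i); rewrite !mxE eqxx mulr1n => Zi.
rewrite -(@ler_pXn2r _ 2) ?nnegrE // expr1n -Zi (bigD1 x) //= !mxE mulrC normCK.
rewrite lerDl; apply: sumr_ge0 => y _; rewrite !mxE mulrC -normCK.
exact: exprn_ge0.
Qed.

(** The constant of the Cauchy-Binet estimate; it does not involve the exponent [m]. *)
Definition sum_minors k (U : 'M[K]_n) : K :=
  \sum_(f : {ffun 'I_k -> 'I_n})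
    (\sum_(g : {ffun 'I_k -> 'I_n}) `|\det (mxsub f g U)|) ^+ 2.

Lemma sum_minors_ge0 k (U : 'M[K]_n) : 0 <= sum_minors k U.
Proof. by apply: sumr_ge0 => f _; rewrite exprn_ge0 // sumr_ge0. Qed.

(** In rotated coordinates the frame is mapped to [Y], the product of the diagonal of powers of [a],
    [V *m W^t*], the diagonal of powers of [b], and an isometry [Z]. Expanding the minors of [Y]
    leaves minors of [V *m W^t*] with weights at most [M ^+ m]. *)
Lemma top_det_minors k V W (a b : 'rV[K]_n) (M t : K) (m : nat) :
    V \is unitarymx -> W \is unitarymx ->
    (forall i, 0 <= a ord0 i) -> (forall i, 0 <= b ord0 i) -> 0 <= M ->
    (forall f g : {ffun 'I_k -> 'I_n}, \det (mxsub f g (V *m W^t*)) != 0 ->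
       \prod_i a ord0 (f i) * \prod_i b ord0 (g i) <= M) ->
    let X := spec V (map_mx (fun z => z ^+ m) a) *m
             spec W (map_mx (fun z => z ^+ m) b) in
    is_top_det k (X^t* *m X) t ->
  t <= sum_minors k (V *m W^t*) * M ^+ m ^+ 2.
Proof.
move=> Vu Wu a0 b0 M0 minor_le X [_ [Q [D [QQ XQ detD]]]].
set U := V *m W^t*; pose Z := W *m Q; pose Y := V *m X *m Q.
have ZZ : Z^t* *m Z = 1%:M by rewrite gram_unitary.
have tE : t = \det (Y^t* *m Y).
  rewrite /Y -mulmxA gram_unitary // trmxC_mul -mulmxA [X^t* *m _]mulmxA XQ.
  by rewrite mulmxA QQ mul1mx detD.
have YE : Y = diag_mx (map_mx (fun z => z ^+ m) a) *m U *m
              (diag_mx (map_mx (fun z => z ^+ m) b) *m Z).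
  rewrite /Y /X /spec /U /Z !mulmxA (unitarymxP Vu) mul1mx //.
have t0 : 0 <= t by rewrite tE det_gram_ge0.
(* The overcounting factor of the Gram expansion is absorbed, an upper bound being enough. *)
have : t <= t *+ k`! by rewrite -{1}[t]mulr1n ler_wpMn2l // fact_gt0.
move=> /le_trans; apply; rewrite tE det_gram mulr_suml.
apply: ler_sum => f _; rewrite -exprMn ler_pXn2r ?nnegrE ?normr_ge0 //; last first.
  by rewrite mulr_ge0 ?exprn_ge0 // sumr_ge0.
have -> : rowsub f Y = diag_mx (colsub f (map_mx (fun z => z ^+ m) a)) *m
    (rowsub f U *m (diag_mx (map_mx (fun z => z ^+ m) b) *m Z)).
  by rewrite YE -mulmxA rowsub_mul_diag mul_rowsub_mx.
(* The one-sided expansion leaves products of entries of [Z], each of modulus at most 1, in place of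
   minors of [Z]. *)
rewrite det_mulmx det_diag det_mulmx_colsub mulr_sumr mulr_suml.
apply: le_trans (ler_norm_sum _ _ _) _; apply: ler_sum => g _.
have -> : colsub g (rowsub f U) = mxsub f g U by apply/matrixP=> i j; rewrite !mxE.
have [->|nz] := eqVneq (\det (mxsub f g U)) 0.
  by rewrite mul0r mulr0 normr0 mul0r.
have -> : \prod_i (diag_mx (map_mx (fun z => z ^+ m) b) *m Z) (g i) i =
    (\prod_i b ord0 (g i)) ^+ m * \prod_i Z (g i) i.
  by rewrite -prodrXl -big_split; apply: eq_bigr => i _; rewrite mul_diag_mx !mxE.
have -> : \prod_i colsub f (map_mx (fun z => z ^+ m) a) ord0 i =
    (\prod_i a ord0 (f i)) ^+ m.
  by rewrite -prodrXl; apply: eq_bigr => i _; rewrite !mxE.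
set pa := \prod_i a _ _; set pb := \prod_i b _ _.
have pa0 : 0 <= pa by apply: prodr_ge0.
have pb0 : 0 <= pb by apply: prodr_ge0.
rewrite mulrCA mulrA -mulrA !normrM ler_wpM2l //.
rewrite mulrA !normrX -exprMn (ger0_norm pa0) (ger0_norm pb0).
rewrite -[leRHS]mulr1 ler_pM ?exprn_ge0 ?mulr_ge0 //.
  by apply: lerXn2r; rewrite ?nnegrE ?mulr_ge0 //; apply: minor_le.
rewrite normr_prod; apply: prodr_ile1 => i _.
by rewrite normr_ge0 frame_entry_le1.
Qed.

End UnitaryDiag.

(** * Kronecker sums and log-majorization *)

Section Iteration.
Variables (K : numClosedFieldType) (n k : nat) (V W : 'M[K]_n).
Variables (a b : 'rV[K]_n) (M : K).
Hypotheses (Vu : V \is unitarymx) (Wu : W \is unitarymx).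
Hypotheses (a0 : forall i, 0 <= a ord0 i) (b0 : forall i, 0 <= b ord0 i).
Hypothesis (M0 : 0 <= M).
Hypothesis minor_le : forall f g : {ffun 'I_k -> 'I_n},
  \det (mxsub f g (V *m W^t*)) != 0 ->
  \prod_i a ord0 (f i) * \prod_i b ord0 (g i) <= M.

Let pow2 (j : nat) : 'rV[K]_n -> 'rV[K]_n := map_mx (fun z => z ^+ (2 ^ j)).
Let A j := spec V (pow2 j a).
Let B j := spec W (pow2 j b).

(** Each [A j] squares to [A j.+1], and likewise for [B], so the doubling inequality chains to
    [tau 0 ^+ (2 ^ j) <= tau j], which the minors then bound. *)
Lemma top_det_pow2 (tau tauB : nat -> K) :
    (forall j, 0 <= tau j) ->
    (forall j, is_top_det k ((A j *m B j)^t* *m (A j *m B j)) (tau j)) ->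
    (forall j, is_top_det k ((B j)^t* *m B j) (tauB j)) ->
  forall j, tau 0 ^+ (2 ^ j) <=
    sum_minors k (V *m W^t*) * (M ^+ 2) ^+ (2 ^ j).
Proof.
move=> tau0 topAB topB j.
have sq U c l : U \is unitarymx -> spec U (pow2 l c) *m spec U (pow2 l c) =
    spec U (pow2 l.+1 c).
  move=> Uu; rewrite specM //; congr (spec _ _).
  by apply/rowP=> i; rewrite !mxE -exprD expnS mul2n addnn.
have pow2_real (c : 'rV[K]_n) l : (forall i, 0 <= c ord0 i) ->
    forall i, pow2 l c ord0 i \is Num.real.
  by move=> c0 i; rewrite mxE ger0_real // exprn_ge0.
have step l : tau l ^+ 2 <= tau l.+1.
  apply: (top_det_double (A := A l) (B := B l) _ _ _ _ _ _ (topB l)) => //.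
  - exact/spec_herm/pow2_real.
  - exact/spec_herm/pow2_real.
  - by rewrite !sq //; apply: topAB.
have iter_le l : tau 0 ^+ (2 ^ l) <= tau l.
  elim: l => [|l IHl]; first by rewrite expr1.
  rewrite expnS mulnC exprM; apply: le_trans (step l).
  by apply: lerXn2r; rewrite ?nnegrE ?exprn_ge0.
apply: le_trans (iter_le j) _; rewrite -exprM mulnC exprM.
exact: top_det_minors (topAB j).
Qed.

End Iteration.

(** * Diagonalisation of Kronecker sums *)

Section KronSpec.
Variables (K : numClosedFieldType) (n : nat) (d : 'I_n -> nat).
Implicit Types U : forall i : 'I_n, 'M[K]_(d i).

Lemma tens_unitary U : (forall i, U i \is unitarymx) ->
  tens_mx U \is unitarymx.
Proof.
move=> Uu; apply/unitarymxP; rewrite tr_tens_mx map_tens_mx tens_mulmx.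
rewrite -tens_mx1; apply: eq_tens_mx => i.
exact/unitarymxP.
Qed.

Lemma tens_trmxC U : (tens_mx U)^t* = tens_mx (fun i => (U i)^t*).
Proof. by rewrite tr_tens_mx map_tens_mx. Qed.

(** Writing each identity factor as [(U j)^t* *m U j] conjugates all summands by the same tensor
    product of unitaries. *)
Lemma kron_sum_spec U (l : forall i : 'I_n, 'rV[K]_(d i)) :
    (forall i, U i \is unitarymx) ->
  kron_sum_mx (fun i => spec (U i) (l i)) = spec (tens_mx U) (kron_sum_row l).
Proof.
move=> Uu; rewrite /spec /kron_sum_row linear_sum /= mulmx_sumr mulmx_suml.
apply: eq_bigr => i _; rewrite -tens_mx_diag tens_trmxC !tens_mulmx.
apply: eq_tens_mx => j; case: eqP => // _.
by rewrite diag_const_mx mulmx1 unitarymxC.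
Qed.

Lemma eq_kron_sum_mx U U' : (forall i, U i = U' i) ->
  kron_sum_mx U = kron_sum_mx U'.
Proof.
move=> UU'; apply: eq_bigr => i _; apply: eq_tens_mx => j.
by case: eqP => // _; apply: UU'.
Qed.

Lemma kron_sum_row_antitone (R : realType) (l : forall i : 'I_n, 'rV[R]_(d i)) :
    (forall i, nonincreasing_row (l i)) ->
  forall x y : 'I_(tdim d), (forall i, midx x i <= midx y i)%N ->
    kron_sum_row l ord0 y <= kron_sum_row l ord0 x.
Proof.
by move=> ldec x y xy; rewrite !kron_sum_rowE ler_sum // => i _; apply: ldec.
Qed.

Lemma kron_sum_row_ge0 (R : realType) (l : forall i : 'I_n, 'rV[R]_(d i)) :
    (forall i j, 0 <= l i ord0 j) ->
  forall x, 0 <= kron_sum_row l ord0 x.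
Proof. by move=> l0 x; rewrite kron_sum_rowE sumr_ge0. Qed.

End KronSpec.

(** * Ordered eigenvalues of complex Hermitian matrices *)

Section Eigenvalues.
Variable R : realType.
Implicit Types n k : nat.

Definition toC n (a : 'rV[R]_n) : 'rV[R[i]]_n := map_mx (real_complex R) a.

Lemma toC_kron_sum_row n (d : 'I_n -> nat) (l : forall i : 'I_n, 'rV[R]_(d i)) :
  toC (kron_sum_row l) = kron_sum_row (fun i => toC (l i)).
Proof.
apply/rowP=> x; rewrite mxE !kron_sum_rowE rmorph_sum.
by apply: eq_bigr => i _; rewrite mxE.
Qed.

Lemma prod_toC n k (a : 'rV[R]_n) (f : 'I_k -> 'I_n) :
  \prod_i toC a ord0 (f i) = real_complex R (\prod_i a ord0 (f i)).
Proof. by rewrite rmorph_prod; apply: eq_bigr => i _; rewrite mxE. Qed.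

(** Two splittings of the characteristic polynomial into linear factors have the same roots up to
    order, and sorting forgets the order. *)
Lemma lambda_spec n (V : 'M[R[i]]_n) a : V \is unitarymx ->
  lambda (spec V (toC a)) = decr a.
Proof.
move=> Vu; rewrite /lambda /eigvals; case: closed_field_poly_normal => r /= rE.
move: rE; rewrite (monicP (char_poly_monic _)) scale1r char_poly_spec // => rE.
have /(perm_map (@complex.Re R)) :
    perm_eq r [seq toC a ord0 i | i <- enum 'I_n].
  by apply: prod_XsubC_eq; rewrite -rE big_map big_enum.
move=> /(perm_decr_row n) ->; rewrite /decr -map_comp.
by congr decr_row; apply: eq_map => i /=; rewrite mxE.
Qed.

(** The spectral theorem lists the real eigenvalues in some order; permuting the rows of the unitary
    matrix along with them sorts the list. *)
Lemma herm_spec n (A : 'M[R[i]]_n) : A \is hermsymmx ->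
  exists2 V, V \is unitarymx & A = spec V (toC (lambda A)).
Proof.
move=> Aherm; pose P := spectralmx A.
have Pu : P \is unitarymx := spectral_unitarymx A.
have /orthomx_spectralP := hermitian_normalmx Aherm.
rewrite invmx_unitary // -/P -/(spec P (spectral_diag A)) => AE.
pose a := map_mx (@complex.Re R) (spectral_diag A).
have aE : toC a = spectral_diag A.
  apply/rowP=> i; rewrite !mxE RRe_real //.
  by have /mxOverP := hermitian_spectral_diag_real Aherm; apply.
have [s sE] := decr_perm a.
exists (perm_mx s *m P); first exact: mul_unitarymx (perm_mx_unitary _ _) Pu.
rewrite [in RHS]AE -aE lambda_spec // {1}AE -aE.
rewrite -(spec_perm s); congr (spec _ _).
by apply/rowP=> i; rewrite [LHS]mxE [LHS]mxE [RHS]mxE sE.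
Qed.

Lemma lambda_nonincreasing n (A : 'M[R[i]]_n) : A \is hermsymmx ->
  nonincreasing_row (lambda A).
Proof.
by move=> /herm_spec[V Vu ->]; rewrite lambda_spec //; apply: decr_nonincreasing.
Qed.

Lemma psd_lambda_ge0 n (A : 'M[R[i]]_n) : psdmx A ->
  forall i, 0 <= lambda A ord0 i.
Proof.
move=> [Aherm Apos] i; have [V Vu AE] := herm_spec Aherm.
(* The quadratic form at the [i]-th eigenvector is the [i]-th eigenvalue. *)
have := Apos (V^t* *m delta_mx i ord0).
by rewrite {1}AE spec_diag_entry // mxE lecR.
Qed.

Lemma psd_gram m n (X : 'M[R[i]]_(m, n)) : psdmx (X^t* *m X).
Proof.
split=> [|u]; first by apply/hermsymmxP; rewrite trmxC_mul trmxCK.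
rewrite mulmxA -trmxC_mul -mulmxA mxE; apply: sumr_ge0 => i _.
by rewrite [_^t* _ _]mxE [_^T _ _]mxE mulrC mul_conjC_ge0.
Qed.

Lemma psd_top_det n k (H : 'M[R[i]]_n) : (k <= n)%N -> psdmx H ->
  is_top_det k H (real_complex R (topk k (lambda H))).
Proof.
move=> kn psdH; have [V Vu HE] := herm_spec (proj1 psdH).
have l0 := psd_lambda_ge0 psdH.
have [h hinj hE] := topk_attained (lambda H) kn.
rewrite {1}HE hE -prod_toC; apply: spec_top_det => // f finj.
by rewrite !prod_toC lecR -hE prod_inj_le_topk.
Qed.

Lemma topk_lambda_gram_le n k (V W : 'M[R[i]]_n) (a b : 'rV[R]_n) (M : R) :
    (k <= n)%N -> V \is unitarymx -> W \is unitarymx ->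
    (forall i, 0 <= a ord0 i) -> (forall i, 0 <= b ord0 i) -> 0 <= M ->
    (forall f g : {ffun 'I_k -> 'I_n}, \det (mxsub f g (V *m W^t*)) != 0 ->
       \prod_i a ord0 (f i) * \prod_i b ord0 (g i) <= M) ->
  topk k (lambda ((spec V (toC a) *m spec W (toC b))^t* *m
                  (spec V (toC a) *m spec W (toC b)))) <= M ^+ 2.
Proof.
move=> kn Vu Wu a0 b0 M0 minor_le; set X := _ *m spec W _.
pose pow2 j : 'rV[R[i]]_n -> 'rV[R[i]]_n := map_mx (fun z => z ^+ (2 ^ j)).
pose Xj j := spec V (pow2 j (toC a)) *m spec W (pow2 j (toC b)).
pose tau j := topk k (lambda ((Xj j)^t* *m Xj j)).
have tau0 j : 0 <= tau j by apply/topk_ge0/psd_lambda_ge0/psd_gram.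
have X0 : Xj 0%N = X.
  have pow0 c : pow2 0%N c = c by apply/rowP=> i; rewrite mxE expr1.
  by rewrite /Xj !pow0.
rewrite -X0 -/(tau 0%N).
have [kap kapE] : exists C : R, forall j,
   real_complex R (tau 0%N) ^+ (2 ^ j) <=
     real_complex R C * (real_complex R M ^+ 2) ^+ (2 ^ j).
  (* The constant is nonnegative in [R[i]], hence real, so the estimate descends to [R], where the
     limit is taken. *)
  exists (complex.Re (sum_minors k (V *m W^t*))) => j.
  rewrite RRe_real; last exact/ger0_real/sum_minors_ge0.
  pose tauB j := topk k (lambda ((spec W (pow2 j (toC b)))^t* *m
                                 spec W (pow2 j (toC b)))).
  apply: (@top_det_pow2 _ _ _ V W (toC a) (toC b) (real_complex R M) Vu Wu _ _ _ _
    (fun j => real_complex R (tau j)) (fun j => real_complex R (tauB j))).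
  - by move=> i; rewrite mxE ler0c.
  - by move=> i; rewrite mxE ler0c.
  - by rewrite ler0c.
  - by move=> f g /minor_le; rewrite !prod_toC -rmorphM lecR.
  - by move=> l; rewrite ler0c.
  - by move=> l; apply/psd_top_det/psd_gram.
  - by move=> l; apply/psd_top_det/psd_gram.
apply: (@le_of_pow2_le _ _ _ kap); first exact: exprn_ge0.
by move=> j; have := kapE j; rewrite -!rmorphXn -rmorphM lecR.
Qed.

End Eigenvalues.

(** * Singular values and the two relations *)

Lemma prod_lambda (R : realType) n (H : 'M[R[i]]_n) : H \is hermsymmx ->
  real_complex R (\prod_i lambda H ord0 i) = \det H.
Proof.
by move=> /herm_spec[V Vu HE]; rewrite {2}HE det_spec // (prod_toC _ id).
Qed.

Lemma sigmaE (R : realType) n (X : 'M[R[i]]_n) i :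
  sigma X ord0 i = Num.sqrt (lambda (X^t* *m X) ord0 i).
Proof. by rewrite mxE. Qed.

Lemma sigma_ge0 (R : realType) n (X : 'M[R[i]]_n) i : 0 <= sigma X ord0 i.
Proof. by rewrite sigmaE sqrtr_ge0. Qed.

Lemma sigma_nonincreasing (R : realType) n (X : 'M[R[i]]_n) :
  nonincreasing_row (sigma X).
Proof.
move=> i j ij; rewrite !sigmaE ler_wsqrtr //.
exact: lambda_nonincreasing (proj1 (psd_gram X)) _ _ ij.
Qed.

Lemma topk_sigma (R : realType) n (X : 'M[R[i]]_n) k :
  topk k (sigma X) ^+ 2 = topk k (lambda (X^t* *m X)).
Proof.
have psdX := psd_gram X; have l0 := psd_lambda_ge0 psdX.
rewrite (topk_id k (@sigma_nonincreasing _ _ X)).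
rewrite (topk_id k (lambda_nonincreasing (proj1 psdX))) -prodrXl.
by apply: eq_bigr => i _; rewrite sigmaE sqr_sqrtr.
Qed.

Lemma topk_all (R : realType) n (x : 'rV[R]_n) : topk n x = \prod_i x ord0 i.
Proof. by rewrite -prod_decr; apply: eq_bigl => i; rewrite ltn_ord. Qed.

(** The case of equality: the squares of both sides are the squared modulus of the determinant of
    the product. *)
Lemma prod_sigma_spec (R : realType) n (V W : 'M[R[i]]_n) (a b : 'rV[R]_n) :
    V \is unitarymx -> W \is unitarymx ->
    (forall i, 0 <= a ord0 i) -> (forall i, 0 <= b ord0 i) ->
  \prod_i sigma (spec V (toC a) *m spec W (toC b)) ord0 i =
  \prod_i cmul a b ord0 i.
Proof.
move=> Vu Wu a0 b0; set X := _ *m _.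
have ab0 i : 0 <= cmul a b ord0 i by rewrite mxE mulr_ge0.
apply/eqP; rewrite -(@eqrXn2 _ 2) ?prodr_ge0 //; last by move=> i _; apply: sigma_ge0.
apply/eqP; rewrite -topk_all topk_sigma topk_all.
apply: (@complexI R); rewrite prod_lambda; last exact: (proj1 (psd_gram X)).
have -> : \prod_i cmul a b ord0 i = \prod_i a ord0 i * \prod_i b ord0 i.
  by rewrite -big_split; apply: eq_bigr => i _; rewrite mxE.
rewrite det_gram_sqr det_mulmx (det_spec _ Vu) (det_spec _ Wu).
rewrite !(prod_toC _ id) -rmorphM.
rewrite ger0_norm; first by rewrite rmorphXn.
by rewrite ler0c mulr_ge0 // prodr_ge0.
Qed.

Lemma log_maj_sigma_spec (R : realType) n (V W : 'M[R[i]]_n) (a b : 'rV[R]_n) :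
    V \is unitarymx -> W \is unitarymx ->
    (forall i, 0 <= a ord0 i) -> (forall i, 0 <= b ord0 i) ->
    (forall k (f g : 'I_k -> 'I_n), \det (mxsub f g (V *m W^t*)) != 0 ->
       \prod_i a ord0 (f i) * \prod_i b ord0 (g i) <= topk k (cmul a b)) ->
  log_maj (sigma (spec V (toC a) *m spec W (toC b))) (decr (cmul a b)).
Proof.
move=> Vu Wu a0 b0 minor_le.
have ab0 x : 0 <= cmul a b ord0 x by rewrite mxE mulr_ge0.
split.
- exact: sigma_ge0.
- exact: decr_ge0.
- move=> k /andP[_ kn]; set X := _ *m _.
  have s0 : 0 <= topk k (sigma X) by apply: topk_ge0; apply: sigma_ge0.
  have ab_k0 := topk_ge0 k ab0.
  change (topk k (sigma X) <= topk k (decr (cmul a b))).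
  rewrite topk_decr -(@ler_pXn2r _ 2) ?nnegrE // topk_sigma.
  exact: topk_lambda_gram_le kn Vu Wu a0 b0 ab_k0 (fun f g => minor_le k f g).
- by rewrite !prod_decr; apply: prod_sigma_spec.
Qed.

Lemma kron_sum_psd_spec (R : realType) n (d : 'I_n -> nat)
    (C : forall i : 'I_n, 'M[R[i]]_(d i)) : (forall i, psdmx (C i)) ->
  exists2 V : forall i, 'M[R[i]]_(d i), forall i, V i \is unitarymx &
    kron_sum_mx C =
      spec (tens_mx V) (toC (kron_sum_row (fun i => lambda (C i)))).
Proof.
move=> psdC; have /fin_all_exists2[V Vu CE] i := herm_spec (proj1 (psdC i)).
exists V; first exact: Vu.
by rewrite (eq_kron_sum_mx CE) (kron_sum_spec _ Vu) toC_kron_sum_row.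
Qed.

(** The transition matrix between the two eigenbases is the tensor product of the [V i *m (W i)^t*],
    so its nonvanishing minors obey [tens_minor_bound]. *)
Lemma log_maj_tens (R : realType) n (d : 'I_n -> nat)
    (V W : forall i : 'I_n, 'M[R[i]]_(d i)) (a b : 'rV[R]_(tdim d))
    (A B : 'M[R[i]]_(tdim d)) :
    (forall i, V i \is unitarymx) -> (forall i, W i \is unitarymx) ->
    (forall x, 0 <= a ord0 x) -> (forall x, 0 <= b ord0 x) ->
    (forall x y, (forall i, midx x i <= midx y i)%N -> a ord0 y <= a ord0 x) ->
    (forall x y, (forall i, midx x i <= midx y i)%N -> b ord0 y <= b ord0 x) ->
    A = spec (tens_mx V) (toC a) -> B = spec (tens_mx W) (toC b) ->
  [/\ log_maj (sigma (A *m B)) (decr (cmul a b)),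
      log_maj (decr (cmul a b)) (cmul (decr a) (decr b))
    & cmul (decr a) (decr b) = cmul (lambda A) (lambda B)].
Proof.
move=> Vu Wu a0 b0 adec bdec -> ->.
have tVu := tens_unitary Vu; have tWu := tens_unitary Wu.
split.
- apply: (log_maj_sigma_spec tVu tWu a0 b0) => k f g.
  rewrite tens_trmxC tens_mulmx; exact: tens_minor_bound.
- exact: log_maj_cmul_decr a0 b0.
- by rewrite (lambda_spec _ tVu) (lambda_spec _ tWu).
Qed.

Theorem corollary4 (R : realType) (n : nat) (d : 'I_n -> nat)
    (n_gt0 : (0 < n)%N) (d_gt0 : forall i, (0 < d i)%N)
    (A_ B_ : forall i : 'I_n, 'M[R[i]]_(d i))
    (psdA : forall i, psdmx (A_ i)) (psdB : forall i, psdmx (B_ i)) :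
  let A := kron_sum_mx A_ in
  let B := kron_sum_mx B_ in
  let a := kron_sum_row (fun i => lambda (A_ i)) in
  let b := kron_sum_row (fun i => lambda (B_ i)) in
  [/\ log_maj (sigma (A *m B)) (decr (cmul a b)),
      log_maj (decr (cmul a b)) (cmul (decr a) (decr b))
    & cmul (decr a) (decr b) = cmul (lambda A) (lambda B)].
Proof.
move=> A B a b.
have [V Vu AE] := kron_sum_psd_spec psdA.
have [W Wu BE] := kron_sum_psd_spec psdB.
have adec i := lambda_nonincreasing (proj1 (psdA i)).
have bdec i := lambda_nonincreasing (proj1 (psdB i)).
have a0 := kron_sum_row_ge0 (fun i => psd_lambda_ge0 (psdA i)).
have b0 := kron_sum_row_ge0 (fun i => psd_lambda_ge0 (psdB i)).
exact: log_maj_tens Vu Wu a0 b0 (kron_sum_row_antitone adec)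
  (kron_sum_row_antitone bdec) AE BE.
Qed.
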